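(* For any bounded lattice $L$ equipped with a protocomplementation $\neg$, the expansion $(L,\neg)$ embeds into the lattice $\mathfrak{L}(X,\vartriangleleft)$ of $c_\vartriangleleft$-fixpoints of a compatibility frame $(X,\vartriangleleft)$ equipped with $\neg_\vartriangleleft$ (that is, there is a lattice embedding $\varphi$ with $\varphi(\neg a)=\neg_\vartriangleleft\varphi(a)$ for all $a\in L$), and if $L$ is complete, the embedding is an isomorphism.
   Context: A compatibility frame is a pair $(X,\vartriangleleft)$ with $X$ a nonempty set and $\vartriangleleft$ a reflexive binary relation on $X$. Write $y\vartriangleright x$ for $x\vartriangleleft y$, and for $A\subseteq X$ let $c_\vartriangleleft(A)=\{x\in X\mid \forall x'\vartriangleleft x\ \exists x''\vartriangleright x':\ x''\in A\}$. This is a closure operator on $\wp(X)$. A $c_\vartriangleleft$-fixpoint is an $A\subseteq X$ with $c_\vartriangleleft(A)=A$. $\mathfrak{L}(X,\vartriangleleft)$ is the complete lattice of $c_\vartriangleleft$-fixpoints ordered by $\subseteq$ (meets are intersections; $\bigvee A_i=c_\vartriangleleft(\bigcup A_i)$). For $A\subseteq X$, $\neg_\vartriangleleft A=\{x\in X\mid \forall y\vartriangleleft x,\ y\notin A\}$, which is always a $c_\vartriangleleft$-fixpoint. A protocomplementation on a bounded lattice $L$ is a unary operation $\neg$ that is antitone ($a\leq b$ implies $\neg b\leq\neg a$), a semicomplementation ($a\wedge\neg a=0$ for all $a$), and satisfies $\neg 0=1$.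
   Formalization: The bounded lattice L is assumed nontrivial (0 ≠ 1); for the one-element lattice the claim fails, since the empty set and X are distinct fixpoints of any compatibility frame with X nonempty, so no embedding can commute with negation. *)

(* Defs.v *)
From HB Require Import structures.
From mathcomp Require Import all_boot all_order.
From mathcomp Require Import boolp classical_sets.

Set Implicit Arguments.
Unset Strict Implicit.
Unset Printing Implicit Defensive.

Import Order.Theory.

Local Open Scope classical_set_scope.
Local Open Scope order_scope.

Record compat_frame := CompatFrame {
  frame_point :> Type;
  compat : frame_point -> frame_point -> Prop;
  frame_nonempty : inhabited frame_point;
  compat_refl : forall x, compat x x
}.

Notation "x '<|c' y" := (compat x y) (at level 70, no associativity).

Section CompatFrame.
Variable F : compat_frame.
Implicit Types A B : set F.

Definition compat_cl A : set F :=
  [set x | forall x', x' <|c x -> exists x'', x' <|c x'' /\ A x''].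

Definition compat_neg A : set F := [set x | forall y, y <|c x -> ~ A y].

Lemma sub_compat_cl A : A `<=` compat_cl A.
Proof. by move=> x Ax x' x'x; exists x. Qed.

Lemma compat_clS A B : A `<=` B -> compat_cl A `<=` compat_cl B.
Proof. by move=> AB x cx x' /cx[x'' [? /AB]]; exists x''. Qed.

Lemma compat_cl_idem A : compat_cl (compat_cl A) = compat_cl A.
Proof.
apply/seteqP; split; last exact: sub_compat_cl.
by move=> x cx x' /cx[y [x'y cy]]; exact: cy.
Qed.

Lemma compat_cl_neg A : compat_cl (compat_neg A) = compat_neg A.
Proof.
apply/seteqP; split; last exact: sub_compat_cl.
by move=> x cx y /cx[z [yz nz]]; exact: nz.
Qed.

Lemma compat_cl_bigcap I (S : set I) (f : I -> set F) :
  (forall i, S i -> compat_cl (f i) = f i) ->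
  compat_cl (\bigcap_(i in S) f i) = \bigcap_(i in S) f i.
Proof.
move=> fixS; apply/seteqP; split; last exact: sub_compat_cl.
move=> x cx i Si; rewrite -(fixS _ Si).
by apply: compat_clS cx => y; exact.
Qed.

Lemma compat_clI A B : compat_cl A = A -> compat_cl B = B ->
  compat_cl (A `&` B) = A `&` B.
Proof.
move=> fA fB; apply/seteqP; split; last exact: sub_compat_cl.
by move=> x cx; split; [rewrite -fA|rewrite -fB];
  apply: compat_clS cx => y [].
Qed.

Lemma compat_cl0 : compat_cl set0 = set0.
Proof.
by apply/seteqP; split=> // x /(_ x (compat_refl x))[y []].
Qed.

Lemma compat_clT : compat_cl setT = setT.
Proof. by apply/seteqP; split=> [//|]; exact: sub_compat_cl. Qed.

Record fixpoint := MkFixpoint {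
  fixpoint_set :> set F;
  fixpoint_setP : compat_cl fixpoint_set == fixpoint_set
}.

HB.instance Definition _ := [isSub for fixpoint_set].
HB.instance Definition _ := [Choice of fixpoint by <:].

Fact fixpoint_display : Order.disp_t. Proof. by []. Qed.

Let fixpoint_le (A B : fixpoint) : bool := `[< fixpoint_set A `<=` fixpoint_set B >].

Fact fixpoint_le_refl : reflexive fixpoint_le.
Proof. by move=> A; apply/asboolP. Qed.

Fact fixpoint_le_anti : antisymmetric fixpoint_le.
Proof.
by move=> A B /andP[/asboolP AB /asboolP BA]; apply/val_inj/seteqP.
Qed.

Fact fixpoint_le_trans : transitive fixpoint_le.
Proof.
by move=> B A C /asboolP AB /asboolP BC; apply/asboolP/(subset_trans AB).
Qed.

HB.instance Definition _ := Order.Le_isPOrder.Build fixpoint_display fixpoint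
  fixpoint_le_refl fixpoint_le_anti fixpoint_le_trans.

Lemma fixpoint_leP (A B : fixpoint) :
  reflect (fixpoint_set A `<=` fixpoint_set B) (A <= B).
Proof. exact: asboolP. Qed.

Lemma fixpoint_setE (A : fixpoint) : compat_cl A = A.
Proof. exact/eqP/fixpoint_setP. Qed.

Definition fixpoint_of A (fixA : compat_cl A = A) : fixpoint :=
  MkFixpoint (introT eqP fixA).

Definition fixpoint_meet (A B : fixpoint) : fixpoint :=
  fixpoint_of (compat_clI (fixpoint_setE A) (fixpoint_setE B)).

Definition fixpoint_join (A B : fixpoint) : fixpoint :=
  fixpoint_of (compat_cl_idem (fixpoint_set A `|` fixpoint_set B)).

Fact fixpoint_meetP (A B C : fixpoint) :
  (A <= fixpoint_meet B C) = (A <= B) && (A <= C).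
Proof.
apply/fixpoint_leP/andP => /= [|[/fixpoint_leP AB /fixpoint_leP AC]].
  by rewrite subsetI => -[AB AC]; split; apply/fixpoint_leP.
by rewrite subsetI.
Qed.

Fact fixpoint_joinP (A B C : fixpoint) :
  (fixpoint_join A B <= C) = (A <= C) && (B <= C).
Proof.
apply/fixpoint_leP/andP => /= [ABC|[/fixpoint_leP AC /fixpoint_leP BC]].
  by split; apply/fixpoint_leP => x ?; apply/ABC/sub_compat_cl; [left|right].
by rewrite -(fixpoint_setE C); apply: compat_clS; rewrite subUset.
Qed.

HB.instance Definition _ := Order.POrder_MeetJoin_isLattice.Build
  fixpoint_display fixpoint fixpoint_meetP fixpoint_joinP.

Fact fixpoint_le0x (A : fixpoint) : fixpoint_of compat_cl0 <= A.
Proof. by apply/fixpoint_leP => x. Qed.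

Fact fixpoint_lex1 (A : fixpoint) : A <= fixpoint_of compat_clT.
Proof. by apply/fixpoint_leP => x. Qed.

HB.instance Definition _ :=
  Order.hasBottom.Build fixpoint_display fixpoint fixpoint_le0x.
HB.instance Definition _ :=
  Order.hasTop.Build fixpoint_display fixpoint fixpoint_lex1.

Definition fixpoint_neg (A : fixpoint) : fixpoint :=
  fixpoint_of (compat_cl_neg A).

End CompatFrame.

Definition complete_lattice d (L : porderType d) : Prop :=
  forall S : set L, supremums S !=set0 /\ infimums S !=set0.

Section Complete.
Variable F : compat_frame.
Implicit Type S : set (fixpoint F).

Lemma fixpoint_sup S :
  supremums S (fixpoint_of (compat_cl_idem (\bigcup_(A in S) fixpoint_set A))).
Proof.
split=> [A SA|B SB]; apply/fixpoint_leP => /=.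
  by move=> x Ax; apply: sub_compat_cl; exists A.
rewrite -(fixpoint_setE B); apply: compat_clS => x [A SA Ax].
by have /fixpoint_leP := SB _ SA; exact.
Qed.

Lemma fixpoint_inf S :
  infimums S (fixpoint_of (compat_cl_bigcap (fun A (_ : S A) => fixpoint_setE A))).
Proof.
split=> [A SA|B SB]; apply/fixpoint_leP => /=; first by move=> x; exact.
by move=> x Bx A SA; have /fixpoint_leP := SB _ SA; exact.
Qed.

Lemma fixpoint_complete : complete_lattice (fixpoint F).
Proof.
by move=> S; split; eexists; [exact: fixpoint_sup|exact: fixpoint_inf].
Qed.

End Complete.

Record protocomplementation d (L : tbLatticeType d) (neg : L -> L) : Prop :=
  Protocomplementation {
    protocompl_anti : forall a b, a <= b -> neg b <= neg a;
    protocompl_semi : forall a, a `&` neg a = \bot;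
    protocompl_bot : neg \bot = \top
  }.

Record neg_embedding d (L : tbLatticeType d) (neg : L -> L)
    d' (M : tbLatticeType d') (neg' : M -> M)
    (phi : {lmorphism L -> M}) : Prop := NegEmbedding {
  neg_embedding_inj : injective phi;
  neg_embedding_bot : phi \bot = \bot;
  neg_embedding_top : phi \top = \top;
  neg_embedding_neg : forall a, phi (neg a) = neg' (phi a)
}.

(* Main.v *)
Require Import Defs.
From HB Require Import structures.
From mathcomp Require Import all_boot all_order.
From mathcomp Require Import boolp classical_sets.

Import Order.Theory.

(** The frame consists of the pairs [(a, b)] with [~~ (a <= b)] and
    [neg a <= b].  Such a pair behaves like a filter-ideal pair with principal
    components: it asserts [a] and rejects [b].  A pair [x] is declared open
    to a pair [y] (that is, [y <|c x]) when what [x] asserts is not below what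
    [y] rejects; the first condition on pairs makes this relation reflexive.
    An element [u] of [L] is represented by the set of pairs asserting
    something below [u].

    Two families of pairs do all the work.  If [u != \top], then [(\top, u)]
    is a pair, because [neg \top = \bot]; it refutes every pair whose first
    component is not below [u], so the set representing [u] is a fixpoint.
    If [u != \bot], then [(u, neg u)] is a pair, because [u <= neg u] would
    force [u = u `&` neg u = \bot]; it is the generic witness of [u], and it
    gives injectivity, preservation of joins, and one half of the preservation
    of negation, where the case [u = \bot] is [neg \bot = \top].  The other
    half is exactly the condition [neg a <= b] on pairs together with
    antitonicity.

    Finally, membership in the closure of a set [A] of pairs depends only on
    which upper bounds the first components of [A] have.  So if these first
    components have a supremum [u], then a fixpoint [A] is the set
    representing [u]; hence the embedding is onto when [L] is complete. *)

Section Representation.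

Set Implicit Arguments.
Unset Strict Implicit.
Unset Printing Implicit Defensive.

Local Open Scope classical_set_scope.
Local Open Scope order_scope.

Context (d : Order.disp_t) (L : tbLatticeType d) (neg : L -> L).
Context (L_nontrivial : \bot != \top :> L).
Context (neg_proto : protocomplementation neg).

Lemma protocompl_top : neg \top = \bot.
Proof. by rewrite -(protocompl_semi neg_proto \top) meet1x. Qed.

Lemma protocompl_le_self u : u <= neg u -> u = \bot.
Proof. by move=> /meet_l uE; rewrite -(protocompl_semi neg_proto u) uE. Qed.

Definition pair_point : Type :=
  {p : L * L | ~~ (p.1 <= p.2) && (neg p.1 <= p.2)}.

Definition asserted (x : pair_point) : L := (sval x).1.
Definition rejected (x : pair_point) : L := (sval x).2.

Lemma asserted_nle_rejected x : ~~ (asserted x <= rejected x).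
Proof. by case/andP: (svalP x). Qed.

Lemma neg_asserted_le_rejected x : neg (asserted x) <= rejected x.
Proof. by case/andP: (svalP x). Qed.

Definition pair_compat (y x : pair_point) : Prop :=
  ~~ (asserted x <= rejected y).

Lemma pair_rejecting u : u != \top ->
  exists x : pair_point, rejected x = u.
Proof.
move=> uT.
have uP : ~~ (\top <= u) && (neg \top <= u).
  by rewrite le1x uT protocompl_top le0x.
by exists (exist _ (\top, u) uP).
Qed.

Lemma pair_asserting u : u != \bot ->
  exists2 x : pair_point, asserted x = u & rejected x = neg u.
Proof.
move=> u0.
have uP : ~~ (u <= neg u) && (neg u <= neg u).
  by rewrite lexx andbT; apply: contra u0 => /protocompl_le_self ->.
by exists (exist _ (u, neg u) uP).
Qed.

Lemma pair_point_inhabited : inhabited pair_point.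
Proof. by have [x _] := pair_rejecting L_nontrivial. Qed.

Definition pair_frame : compat_frame :=
  @CompatFrame pair_point pair_compat pair_point_inhabited
    asserted_nle_rejected.

Lemma nle_neq0 (u v : L) : ~~ (u <= v) -> u != \bot.
Proof. by apply: contraNneq => ->; exact: le0x. Qed.

(** The quantifier over [x''] in the closure only tests whether the asserted
    components of [A] escape a given rejected component.  The hypothesis says
    that [u] escapes only when some member of [A] does, that is, that [u] is
    below every upper bound of those components. *)
Lemma compat_cl_asserted (A : set pair_frame) u :
    (forall v, (forall x, A x -> asserted x <= v) -> u <= v) ->
  [set x : pair_frame | asserted x <= u] `<=` compat_cl A.
Proof.
move=> u_lub x /= xu y yx; apply: contrapT => noA.
suff uy : u <= rejected y by move/negP: yx; apply; exact: le_trans xu uy.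
apply: u_lub => z Az; apply: contrapT => /negP zy.
by apply: noA; exists z.
Qed.

Lemma compat_cl_le u : compat_cl [set x : pair_frame | asserted x <= u]
  = [set x : pair_frame | asserted x <= u].
Proof.
apply/seteqP; split; last exact: sub_compat_cl.
move=> x /= clx; apply: contrapT => /negP xu.
have uT : u != \top by apply: contraNneq xu => ->; exact: lex1.
have [y yu] := pair_rejecting uT.
have [|z [/= yz zu]] := clx y; first by rewrite /= /pair_compat yu.
by move: yz; rewrite /pair_compat yu zu.
Qed.

Definition represent (u : L) : fixpoint pair_frame :=
  fixpoint_of (compat_cl_le u).

Lemma represent_le u v : (represent u <= represent v) = (u <= v).
Proof.
apply/fixpoint_leP/idP => [uv|uv x /= xu]; last exact: le_trans xu uv.
have [->|u0] := eqVneq u \bot; first exact: le0x.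
have [x xu _] := pair_asserting u0.
by rewrite -xu; apply: uv; rewrite /= xu.
Qed.

Lemma represent_inj : injective represent.
Proof.
by move=> u v uv; apply/le_anti; rewrite -!represent_le uv lexx.
Qed.

Lemma representI : {morph represent : u v / u `&` v}.
Proof.
move=> u v; apply/le_anti; rewrite lexI !represent_le leIl leIr /=.
by apply/fixpoint_leP => x /= [xu xv]; rewrite lexI xu.
Qed.

Lemma representU : {morph represent : u v / u `|` v}.
Proof.
move=> u v; apply/le_anti/andP; split; last first.
  by rewrite leUx !represent_le leUl leUr.
apply/fixpoint_leP; apply: compat_cl_asserted => w uvw.
rewrite leUx; apply/andP; split.
- have [->|u0] := eqVneq u \bot; first exact: le0x.
  by have [x xu _] := pair_asserting u0; rewrite -xu; apply: uvw; left;
    rewrite /= xu.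
- have [->|v0] := eqVneq v \bot; first exact: le0x.
  by have [x xv _] := pair_asserting v0; rewrite -xv; apply: uvw; right;
    rewrite /= xv.
Qed.

Lemma represent0 : represent \bot = \bot.
Proof.
apply/le_anti; rewrite le0x andbT; apply/fixpoint_leP => x /=.
by move: (nle_neq0 (asserted_nle_rejected x)); rewrite lex0 => /negbTE ->.
Qed.

Lemma represent1 : represent \top = \top.
Proof.
by apply/le_anti; rewrite lex1; apply/fixpoint_leP => x _ /=; exact: lex1.
Qed.

(** The pair [(u, neg u)] is the most demanding test for membership in the
    negation of the set representing [u]: every pair asserting something
    below [u] rejects something above [neg u]. *)
Lemma represent_neg u : represent (neg u) = fixpoint_neg (represent u).
Proof.
apply/val_inj/seteqP; split=> x /= xu.
- move=> y yx yu; move/negP: yx; apply.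
  apply: le_trans xu (le_trans _ (neg_asserted_le_rejected y)).
  exact: (protocompl_anti neg_proto).
- have [->|u0] := eqVneq u \bot.
    by rewrite (protocompl_bot neg_proto) lex1.
  have [y yu yn] := pair_asserting u0.
  apply: contrapT => /negP xn; apply: (xu y); last by rewrite /= yu.
  by rewrite /= /pair_compat yn.
Qed.

Lemma represent_surj : complete_lattice L ->
  forall A : fixpoint pair_frame, exists u, represent u = A.
Proof.
move=> Lc A; have [[u [u_ub u_lub]] _] := Lc (asserted @` fixpoint_set A).
exists u; apply/val_inj/seteqP; split=> /=.
- rewrite -[X in _ `<=` X]fixpoint_setE; apply: compat_cl_asserted => v Av.
  by apply: u_lub => _ [x Ax <-]; exact: Av.
- by move=> x Ax; apply: u_ub; exists x.
Qed.

Lemma represent_bij : complete_lattice L -> bijective represent.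
Proof.
move=> /represent_surj/choice[g gK].
by exists g => // u; apply: represent_inj; rewrite gK.
Qed.

Lemma represent_homo : {homo represent : u v / u <= v}.
Proof. by move=> u v; rewrite represent_le. Qed.

HB.instance Definition _ := Order.isOrderMorphism.Build d L
  fixpoint_display (fixpoint pair_frame) represent represent_homo.
HB.instance Definition _ := Order.isLatticeMorphism.Build d L
  fixpoint_display (fixpoint pair_frame) represent representI representU.

End Representation.

(* Nontriviality is implicit in the nonemptiness of compatibility frames: in
   the lattice of fixpoints of a nonempty frame the bounds (the empty and the
   full set) are distinct, so the one-element lattice embeds into none. *)
Theorem theorem3p19 (d : Order.disp_t) (L : tbLatticeType d) (neg : L -> L)
    (L_nontrivial : (\bot != \top :> L)%O) (Hneg : protocomplementation neg) :
  exists (F : compat_frame) (phi : {lmorphism L -> fixpoint F}),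
    neg_embedding neg (@fixpoint_neg F) phi /\
    (complete_lattice L -> bijective phi).
Proof.
exists (pair_frame L_nontrivial Hneg).
exists (represent L_nontrivial Hneg).
split; last exact: represent_bij.
split.
- exact: represent_inj.
- exact: represent0.
- exact: represent1.
- exact: represent_neg.
Qed.
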